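(* Consider the approximation problem $\mathrm{APP}=\{\mathrm{APP}_s\}_{s\in\mathbb N}$ with the embedding operators $\mathrm{APP}_s:H_{s,\boldsymbol a,\boldsymbol b}\to H_s$. Then: (i) EXP holds for arbitrary $\boldsymbol a$ and $\boldsymbol b$ (satisfying the standing assumptions), with the exponent $p_s^*=\frac1{B_s}$, where $B_s:=\sum_{j=1}^s\frac1{b_j}$, for every $s\in\mathbb N$. (ii) UEXP holds if and only if $\boldsymbol a$ is arbitrary and $\boldsymbol b$ is such that $B:=\sum_{j=1}^\infty\frac1{b_j}<\infty$ (that is, UEXP is equivalent to $B<\infty$, with no further condition on $\boldsymbol a$). If $B<\infty$, then the exponent of UEXP is $p^*=1/B$.
   Context: Notation: $\mathbb N=\{1,2,\dots\}$, $\mathbb N_0=\{0,1,2,\dots\}$. Setting. $H$ is an infinite-dimensional separable Hilbert space over $\mathbb R$ or $\mathbb C$ with orthonormal basis $\{e_k\}_{k\in\mathbb N_0}$; $\omega\in(0,1)$; $\boldsymbol m=\{m_k\}_{k\in\mathbb N_0}$ is a bounded sequence of positive integers; $r_0=0$ and $r_k=m_0+\cdots+m_{k-1}$ for $k\ge1$. For $n\in\mathbb N_0$ let $k(n)$ be the unique $k\in\mathbb N_0$ with $r_k\le n\le r_{k+1}-1$. For $a,b>0$ let $$H_{a,b}=\Big\{f\in H:\ \|f\|_{H_{a,b}}:=\Big(\sum_{k=0}^\infty\omega^{-ak^b}\sum_{j=r_k}^{r_{k+1}-1}|\langle f,e_j\rangle_H|^2\Big)^{1/2}<\infty\Big\}.$$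 The sequences $\boldsymbol a=\{a_j\}_{j\in\mathbb N}$, $\boldsymbol b=\{b_j\}_{j\in\mathbb N}$ consist of positive reals with $0<a_1\le a_2\le\cdots$ and $\inf_jb_j>0$ (standing assumptions). Let $H_s=H\otimes\cdots\otimes H$ ($s$-fold Hilbert tensor product) with orthonormal basis $e_{\boldsymbol n}=e_{n_1}\otimes\cdots\otimes e_{n_s}$, $\boldsymbol n\in\mathbb N_0^s$, and $H_{s,\boldsymbol a,\boldsymbol b}=H_{a_1,b_1}\otimes\cdots\otimes H_{a_s,b_s}$; equivalently, $H_{s,\boldsymbol a,\boldsymbol b}$ is the set of $f\in H_s$ with $\|f\|_{H_{s,\boldsymbol a,\boldsymbol b}}^2=\sum_{\boldsymbol n\in\mathbb N_0^s}\omega^{-\sum_{j=1}^sa_j[k(n_j)]^{b_j}}|\langle f,e_{\boldsymbol n}\rangle_{H_s}|^2<\infty$. The operator $\mathrm{APP}_s:H_{s,\boldsymbol a,\boldsymbol b}\to H_s$ is the embedding $\mathrm{APP}_sf=f$. Minimal errors. For $n\in\mathbb N_0$, the $n$th minimal worst case error is $e(n,\mathrm{APP}_s)=\inf_{A_n}\sup_{\|f\|_{H_{s,\boldsymbol a,\boldsymbol b}}\le1}\|f-A_nf\|_{H_s}$, the infimum being over all algorithms $A_nf=\sum_{j=1}^nL_j(f)g_j$ with continuous linear functionals $L_j$ on $H_{s,\boldsymbol a,\boldsymbol b}$ and $g_j\in H_s$ ($A_0=0$). EXP (exponential convergence) holds if there is $q\in(0,1)$ such that for every $s\in\mathbb N$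 there are positive $C_s,M_s,p_s$ with $e(n,\mathrm{APP}_s)\le C_s\,q^{(n/M_s)^{p_s}}$ for all $n\in\mathbb N$. The supremum of the $p_s$ for which such a bound holds is denoted $p_s^*$ (exponent of EXP for the $s$-variate case). UEXP (uniform exponential convergence) holds if one can take $p_s=p>0$ for all $s\in\mathbb N$; the supremum of such $p$ is denoted $p^*$ (exponent of UEXP). *)

(* Defs.v *)
From HB Require Import structures.
From mathcomp Require Import all_boot all_order all_algebra.
From mathcomp Require Import sesquilinear complex.
From mathcomp Require Import all_classical all_reals all_analysis.

Set Implicit Arguments.
Unset Strict Implicit.
Unset Printing Implicit Defensive.

Import Order.TTheory GRing.Theory Num.Theory.
Import numFieldNormedType.Exports.
Local Open Scope classical_set_scope.
Local Open Scope ring_scope.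

(* Hilbert spaces are taken over a field of scalars which is either R or C. *)
Variant scalar_kind := RealScalars | ComplexScalars.

Definition scalar_field (R : realType) (k : scalar_kind) : numFieldType :=
  match k with RealScalars => R | ComplexScalars => R[i] end.

Definition scalar_conj (R : realType) (k : scalar_kind) :
    scalar_field R k -> scalar_field R k :=
  match k with RealScalars => idfun | ComplexScalars => @conjc R end.

Definition scalar_re (R : realType) (k : scalar_kind) : scalar_field R k -> R :=
  match k with RealScalars => idfun | ComplexScalars => @complex.Re R end.

(* The inner product is linear in its first argument. *)
Record hilbertType (R : realType) (k : scalar_kind) := HilbertType {
  hilbert_sort :> completeNormedModType (scalar_field R k);
  inner : {dot hilbert_sort for @scalar_conj R k};
  inner_norm : forall x : hilbert_sort, `|x| ^+ 2 = inner x x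
}.

(* The norm of a normed module over C is a complex number with zero imaginary
   part; rnorm is that number as an element of R. *)
Definition rnorm (R : realType) (k : scalar_kind)
    (V : normedModType (scalar_field R k)) (x : V) : R := scalar_re `|x|.

Definition rabs (R : realType) (k : scalar_kind) (z : scalar_field R k) : R :=
  scalar_re `|z|.

Section HilbertSpaces.
Context {R : realType} {k : scalar_kind}.
Local Notation K := (scalar_field R k).
Local Notation hilbert := (hilbertType R k).

Definition linear_span (V : lmodType K) (S : set V) : set V :=
  [set x | exists N (c : 'I_N -> K) (v : 'I_N -> V),
      (forall i, S (v i)) /\ x = \sum_(i < N) c i *: v i].

Definition orthonormal_basis (H : hilbert) (e : nat -> H) : Prop :=
  (forall i j, inner H (e i) (e j) = (i == j)%:R) /\
  dense (linear_span (range e)).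

(* A Hilbert tensor power of H, specified as usual up to unitary isomorphism:
   a Hilbert space with a multilinear map (x_1, ..., x_s) |-> x_1 (x) ... (x) x_s
   whose range is total and such that inner products of elementary tensors are
   the products of the inner products of the factors. *)
Record tensor_power (H : hilbert) (s : nat) := TensorPower {
  tensor_space :> hilbert;
  tensor : ('I_s -> H) -> tensor_space;
  tensor_multilinear : forall (u : 'I_s -> H) (i : 'I_s) (c : K) (x y : H),
    tensor (@dfwith _ (fun=> H : Type) u i (c *: x + y)) =
    c *: tensor (@dfwith _ (fun=> H : Type) u i x)
    + tensor (@dfwith _ (fun=> H : Type) u i y);
  tensor_inner : forall u v : 'I_s -> H,
    inner tensor_space (tensor u) (tensor v) =
    \prod_(i < s) inner H (u i) (v i);
  tensor_total : dense (linear_span (range tensor))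
}.

End HilbertSpaces.

Definition block_start (m : nat -> nat) (k : nat) : nat := \sum_(i < k) m i.

Definition block_index (m : nat -> nat) (n : nat) : nat :=
  get [set k | (block_start m k <= n < block_start m k.+1)%N].

Section WeightedSpace.
Context {R : realType} {k : scalar_kind} {H : hilbertType R k}.
(* Sequences indexed by j >= 1 are shifted: a j and b j stand for the
   (j+1)-st weights. *)
Variables (e : nat -> H) (omega : R) (m : nat -> nat) (a b : nat -> R).
Variables (s : nat) (Hs : tensor_power H s).
Local Notation K := (scalar_field R k).

Definition tensor_basis (n : {ffun 'I_s -> nat}) : Hs :=
  tensor Hs (fun j => e (n j)).

Definition weight (n : {ffun 'I_s -> nat}) : R :=
  omega `^ (- \sum_(j < s) a j * (block_index m (n j))%:R `^ b j).

(* The norm of H_{s,a,b}, with value +oo outside H_{s,a,b}. *)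
Definition weighted_norm (f : Hs) : \bar R :=
  ((\esum_(n in [set: {ffun 'I_s -> nat}])
     (weight n * rabs (inner Hs f (tensor_basis n)) ^+ 2)%:E) `^ 2^-1)%E.

Definition weighted_space : set Hs := [set f | (weighted_norm f < +oo)%E].

(* Continuous linear functionals on H_{s,a,b}; the values of L outside
   H_{s,a,b} are irrelevant. *)
Definition continuous_functional (L : Hs -> K) : Prop :=
  (forall (c : K) (f g : Hs), weighted_space f -> weighted_space g ->
     L (c *: f + g) = c * L f + L g) /\
  (forall f : Hs, weighted_space f -> forall eps : R, 0 < eps ->
     exists2 delta : R, 0 < delta &
       forall g : Hs, weighted_space g ->
         (weighted_norm (g - f)%R < delta%:E)%E -> rabs (L g - L f) < eps).

Definition algorithms (n : nat) : set (Hs -> Hs) :=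
  [set A | exists (L : 'I_n -> Hs -> K) (g : 'I_n -> Hs),
      (forall i, continuous_functional (L i)) /\
      A = (fun f => \sum_(i < n) L i f *: g i)].

Definition worst_case_error (A : Hs -> Hs) : \bar R :=
  ereal_sup [set (rnorm (f - A f))%:E | f in
               [set f : Hs | (weighted_norm f <= 1)%E]].

Definition minimal_error (n : nat) : \bar R :=
  ereal_inf [set worst_case_error A | A in algorithms n].

End WeightedSpace.

Section ExponentialConvergence.
Context {R : realType}.

Definition exp_bound (err : nat -> \bar R) (q p : R) : Prop :=
  exists C M : R, [/\ 0 < C, 0 < M &
    forall n : nat, (0 < n)%N ->
      (err n <= (C * q `^ ((n%:R / M) `^ p))%:E)%E].

(* In the following, err s n is the n-th minimal error in dimension s. *)
Variable err : nat -> nat -> \bar R.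

Definition EXP : Prop :=
  exists2 q : R, 0 < q < 1 &
    forall s, (0 < s)%N -> exists2 p : R, 0 < p & exp_bound (err s) q p.

Definition EXP_exponent (s : nat) : \bar R :=
  ereal_sup [set p%:E | p in [set p : R | 0 < p /\
    exists2 q : R, 0 < q < 1 & exp_bound (err s) q p]].

Definition UEXP_with (p : R) : Prop :=
  0 < p /\ exists2 q : R, 0 < q < 1 &
    forall s, (0 < s)%N -> exp_bound (err s) q p.

Definition UEXP : Prop := exists p : R, UEXP_with p.

Definition UEXP_exponent : \bar R :=
  ereal_sup [set p%:E | p in [set p : R | UEXP_with p]].

End ExponentialConvergence.

(* Main.v *)
Require Import Defs.
From mathcomp Require Import all_boot all_order all_algebra.
From mathcomp Require Import sesquilinear complex ring lra.
From mathcomp Require Import all_classical all_reals all_analysis.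
Import Order.TTheory GRing.Theory Num.Theory.
Import numFieldNormedType.Exports.
Local Open Scope classical_set_scope.
Local Open Scope ring_scope.

(* With c(n) = sum_j a_j k(n_j)^(b_j), the weight of the basis vector e_n is
   omega^(-c(n)).  If all indices with c(n) < T belong to a set of at most N
   elements, the projection onto the corresponding basis vectors shows that
   e(N) <= omega^(T/2); if more than N indices have c(n) <= T, then some
   vector of the span of these e_n is annihilated by any given N functionals,
   so e(N) >= omega^(T/2).  By comparison with boxes, the number of indices with
   c(n) <= T lies between c T^(B_s) and C (1+T)^(B_s).
   Hence ln(1/e(N)) has order N^(1/B_s) exactly, which gives (i), with a base
   omega^(1/2) that does not depend on s.  Statement (ii) follows since B is the
   supremum of the B_s and the bound with exponent p implies the bound with any
   smaller exponent. *)

(** * Real-valued norms and inner products, uniformly over both scalar fields *)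

Section Scalars.
Context {R : realType} {k : scalar_kind}.
Local Notation K := (scalar_field R k).

(** A right inverse of [scalar_re] that preserves sums, products and order. Statements about the
    real numbers [rnorm] and [rabs] are transported along it to [K], where the norm takes its
    values. *)
Definition scalar_of_real : R -> K :=
  match k return R -> scalar_field R k with
  | RealScalars => idfun
  | ComplexScalars => real_complex R
  end.

Lemma scalar_of_realK (x : R) : scalar_re (scalar_of_real x) = x.
Proof. by rewrite /scalar_of_real; case: k. Qed.

Lemma scalar_of_real_rnorm {V : normedModType K} (x : V) :
  scalar_of_real (rnorm x) = `|x|.
Proof.
rewrite /rnorm; have := normr_ge0 x; move: `|x|.
rewrite /scalar_of_real /scalar_re; case: k => //= z z0.
by apply: RRe_real; rewrite realE z0.
Qed.

Lemma scalar_of_real_rabs (z : K) : scalar_of_real (rabs z) = `|z|.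
Proof.
rewrite /rabs; have := normr_ge0 z; move: `|z|.
rewrite /scalar_of_real /scalar_re; case: k => //= w w0.
by apply: RRe_real; rewrite realE w0.
Qed.

Lemma scalar_of_realD x y :
  scalar_of_real (x + y) = scalar_of_real x + scalar_of_real y.
Proof. by rewrite /scalar_of_real; case: k => //; rewrite rmorphD. Qed.

Lemma scalar_of_realM x y :
  scalar_of_real (x * y) = scalar_of_real x * scalar_of_real y.
Proof. by rewrite /scalar_of_real; case: k => //; rewrite rmorphM. Qed.

Lemma scalar_of_real_le x y :
  (scalar_of_real x <= scalar_of_real y) = (x <= y).
Proof. by rewrite /scalar_of_real; case: k => //=; rewrite lecR. Qed.

Lemma scalar_of_real_lt x y :
  (scalar_of_real x < scalar_of_real y) = (x < y).
Proof. by rewrite /scalar_of_real; case: k => //=; rewrite ltcR. Qed.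

Lemma scalar_of_real0 : scalar_of_real 0 = 0.
Proof. by rewrite /scalar_of_real; case: k. Qed.

Lemma scalar_of_realI : injective scalar_of_real.
Proof. exact: can_inj scalar_of_realK. Qed.

Lemma scalar_of_real1 : scalar_of_real 1 = 1.
Proof. by rewrite /scalar_of_real; case: k. Qed.

Lemma scalar_conj0 : scalar_conj (0 : K) = 0.
Proof. by rewrite /scalar_conj; case: k => //=; rewrite raddf0. Qed.

Lemma rabs_ge0 (z : K) : 0 <= rabs z.
Proof. by rewrite -scalar_of_real_le scalar_of_real_rabs scalar_of_real0. Qed.

Lemma rabsM (y z : K) : rabs (y * z) = rabs y * rabs z.
Proof.
by apply: scalar_of_realI; rewrite scalar_of_realM !scalar_of_real_rabs normrM.
Qed.

Lemma rabs0 : rabs (0 : K) = 0.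
Proof.
by apply: scalar_of_realI; rewrite scalar_of_real_rabs normr0 scalar_of_real0.
Qed.

Lemma rabs_eq0 (z : K) : (rabs z == 0) = (z == 0).
Proof.
rewrite -(inj_eq scalar_of_realI) scalar_of_real_rabs scalar_of_real0.
exact: normr_eq0.
Qed.

Lemma rabs_of_real (x : R) : 0 <= x -> rabs (scalar_of_real x) = x.
Proof.
move=> x0; apply: scalar_of_realI; rewrite scalar_of_real_rabs ger0_norm//.
by rewrite -scalar_of_real0 scalar_of_real_le.
Qed.

Section Norm.
Context {V : normedModType K}.
Implicit Types x y : V.

Lemma rnorm_ge0 x : 0 <= rnorm x.
Proof. by rewrite -scalar_of_real_le scalar_of_real_rnorm scalar_of_real0. Qed.

Lemma rnormZ (c : K) x : rnorm (c *: x) = rabs c * rnorm x.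
Proof.
apply: scalar_of_realI.
by rewrite scalar_of_realM scalar_of_real_rabs !scalar_of_real_rnorm normrZ.
Qed.

Lemma rnormD x y : rnorm (x + y) <= rnorm x + rnorm y.
Proof.
by rewrite -scalar_of_real_le scalar_of_realD !scalar_of_real_rnorm ler_normD.
Qed.

Lemma rnorm0 : rnorm (0 : V) = 0.
Proof.
by apply: scalar_of_realI; rewrite scalar_of_real_rnorm normr0 scalar_of_real0.
Qed.

Lemma dense_approx (S : set V) : dense S ->
  forall x (eps : R), 0 < eps -> exists2 y, S y & rnorm (x - y) < eps.
Proof.
move=> dS x eps eps0.
have e0 : 0 < scalar_of_real eps by rewrite -scalar_of_real0 scalar_of_real_lt.
have [|y [xy Sy]] := dS _ _ (ball_open x (scalar_of_real eps)).
  by exists x; exact: ballxx.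
exists y => //; rewrite -scalar_of_real_lt scalar_of_real_rnorm.
by move: xy; rewrite -ball_normE.
Qed.

End Norm.

Section Inner.
Context {E : hilbertType R k}.
Implicit Types x y z : E.

Lemma innerDl x y z : inner E (x + y) z = inner E x z + inner E y z.
Proof. exact: linearDl. Qed.

Lemma innerBl x y z : inner E (x - y) z = inner E x z - inner E y z.
Proof. exact: linearBl. Qed.

Lemma innerZl (c : K) x z : inner E (c *: x) z = c * inner E x z.
Proof. exact: linearZl_LR. Qed.

Lemma inner_suml (I : Type) (r : seq I) (F : I -> E) z :
  inner E (\sum_(i <- r) F i) z = \sum_(i <- r) inner E (F i) z.
Proof. exact: linear_sumlz. Qed.

Lemma innerC x y : inner E y x = scalar_conj (inner E x y).
Proof.
rewrite [LHS](@hermitian_subproof _ _ _ _ (inner E)) expr0 mul1r.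
by [].
Qed.

Lemma innerDr x y z : inner E z (x + y) = inner E z x + inner E z y.
Proof. exact: linearDr. Qed.

Lemma inner_orthC x y : inner E x y = 0 -> inner E y x = 0.
Proof. by move=> xy0; rewrite innerC xy0 scalar_conj0. Qed.

Lemma rnorm_sqr x : scalar_of_real (rnorm x ^+ 2) = inner E x x.
Proof. by rewrite -inner_norm !expr2 scalar_of_realM scalar_of_real_rnorm. Qed.

Lemma rnorm_pythagoras x y : inner E x y = 0 ->
  rnorm (x + y) ^+ 2 = rnorm x ^+ 2 + rnorm y ^+ 2.
Proof.
move=> xy0; apply: scalar_of_realI.
rewrite scalar_of_realD !rnorm_sqr innerDl !innerDr xy0 (inner_orthC _ _ xy0).
by rewrite addr0 add0r.
Qed.

End Inner.

(** * Projections onto finite orthonormal families *)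

Section OrthonormalFamily.
Context {E : hilbertType R k} {I : eqType} (u : I -> E).
Hypothesis u_on : forall i j, inner E (u i) (u j) = (i == j)%:R.

Definition onproj (r : seq I) (f : E) : E :=
  \sum_(i <- r) inner E f (u i) *: u i.

Lemma inner_oncomb (r : seq I) (c : I -> K) j : uniq r ->
  inner E (\sum_(i <- r) c i *: u i) (u j) = if j \in r then c j else 0.
Proof.
move=> ur; rewrite inner_suml.
under eq_bigr do rewrite innerZl u_on.
case: ifPn => jr.
  rewrite (bigD1_seq j)//= eqxx mulr1 big1 ?addr0// => i /negbTE ->.
  by rewrite mulr0.
rewrite big_seq big1// => i ir; case: eqP => [ij|]; last by rewrite mulr0.
by rewrite -ij ir in jr.
Qed.

Lemma orth_oncomb (r : seq I) (c : I -> K) x :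
  (forall i, i \in r -> inner E x (u i) = 0) ->
  inner E x (\sum_(i <- r) c i *: u i) = 0.
Proof.
move=> xr; apply: inner_orthC; rewrite inner_suml big_seq big1// => i ir.
by rewrite innerZl (inner_orthC _ _ (xr i ir)) mulr0.
Qed.

Lemma rnorm_on i : rnorm (u i) = 1.
Proof.
have : rnorm (u i) ^+ 2 = 1.
  by apply: scalar_of_realI; rewrite rnorm_sqr u_on eqxx scalar_of_real1.
move/eqP; rewrite sqrf_eq1 => /orP[/eqP //|/eqP h].
by have := rnorm_ge0 (u i); rewrite h oppr_ge0 ler10.
Qed.

Lemma rnorm_oncomb (r : seq I) (c : I -> K) : uniq r ->
  rnorm (\sum_(i <- r) c i *: u i) ^+ 2 = \sum_(i <- r) rabs (c i) ^+ 2.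
Proof.
elim: r => [|i r IH] /=; first by rewrite !big_nil rnorm0 expr0n.
move=> /andP[ir ur]; rewrite !big_cons rnorm_pythagoras ?IH//.
  by rewrite rnormZ rnorm_on mulr1.
apply: orth_oncomb => j jr; rewrite innerZl u_on; case: eqP => [ij|].
  by rewrite ij jr in ir.
by rewrite mulr0.
Qed.

Lemma orth_sub_onproj (r : seq I) (f : E) i : uniq r -> i \in r ->
  inner E (f - onproj r f) (u i) = 0.
Proof. by move=> ur ir; rewrite innerBl inner_oncomb// ir subrr. Qed.

(** The residual of the projection is orthogonal to the span, and any other combination differs from
    the projection by a vector of the span, so Pythagoras applies. *)
Lemma onproj_best (r : seq I) (f : E) (c : I -> K) : uniq r ->
  rnorm (f - onproj r f) <= rnorm (f - \sum_(i <- r) c i *: u i).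
Proof.
move=> ur; rewrite -(@ler_pXn2r _ 2)// ?nnegrE ?rnorm_ge0//.
have -> : f - \sum_(i <- r) c i *: u i =
    (f - onproj r f) + \sum_(i <- r) (inner E f (u i) - c i) *: u i.
  under [X in _ = _ + X]eq_bigr do rewrite scalerBl.
  by rewrite sumrB addrA subrK.
rewrite [leRHS]rnorm_pythagoras ?lerDl ?sqr_ge0//.
by apply: orth_oncomb => i ir; exact: orth_sub_onproj.
Qed.

(** The residual on [r] is the residual on [r ++ t] plus the projection onto [t], and these two are
    orthogonal. *)
Lemma rnorm_sub_onproj_cat (r t : seq I) (f : E) : uniq (r ++ t) ->
  rnorm (f - onproj r f) ^+ 2 =
  rnorm (f - onproj (r ++ t) f) ^+ 2 +
  \sum_(i <- t) rabs (inner E f (u i)) ^+ 2.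
Proof.
move=> urt; have ut : uniq t by move: urt; rewrite cat_uniq => /and3P[].
rewrite -rnorm_oncomb//.
have -> : f - onproj r f = (f - onproj (r ++ t) f) + onproj t f.
  by rewrite /onproj big_cat/= opprD addrA subrK.
rewrite rnorm_pythagoras//; apply: orth_oncomb => i it.
by apply: orth_sub_onproj => //; rewrite mem_cat it orbT.
Qed.

End OrthonormalFamily.
End Scalars.

(** * Totality of the tensor product basis *)

Section Approximation.
Context {R : realType} {k : scalar_kind}.
Local Notation K := (scalar_field R k).

Section Approximable.
Context {V : normedModType K} {I : Type} (u : I -> V).

(** Membership in the closed linear span of [u]. Combinations are lists of coefficient-index pairs;
    repeated indices are allowed, so that adding combinations is concatenating lists. *)
Definition approximable (f : V) : Prop := forall eps : R, 0 < eps ->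
  exists l : seq (K * I), rnorm (f - \sum_(p <- l) p.1 *: u p.2) < eps.

Lemma approximable_member i : approximable (u i).
Proof.
move=> eps eps0; exists [:: (1, i)].
by rewrite big_seq1 scale1r subrr rnorm0.
Qed.

Lemma approximable0 : approximable 0.
Proof. by move=> eps eps0; exists [::]; rewrite big_nil subrr rnorm0. Qed.

Lemma approximable_lin (c : K) (f g : V) :
  approximable f -> approximable g -> approximable (c *: f + g).
Proof.
move=> af ag eps eps0.
have d0 : 0 < rabs c + 1 by rewrite ltr_wpDl// rabs_ge0.
have [|l1 h1] := af (eps / 2 / (rabs c + 1)); first by rewrite !divr_gt0.
have [|l2 h2] := ag (eps / 2); first by rewrite divr_gt0.
exists ([seq (c * p.1, p.2) | p <- l1] ++ l2).
rewrite big_cat big_map/=.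
under eq_bigr do rewrite -scalerA.
rewrite -scaler_sumr opprD addrACA -scalerBr (le_lt_trans (rnormD _ _))//.
rewrite (splitr eps) ler_ltD// rnormZ.
rewrite (le_trans (y := (rabs c + 1) * (eps / 2 / (rabs c + 1))))//.
  by rewrite ler_pM ?rabs_ge0 ?rnorm_ge0 ?lerDl// ltW.
by rewrite mulrC divfK// gt_eqF.
Qed.

Lemma approximable_sum {J : Type} (l : seq J) (c : J -> K) (F : J -> V) :
  (forall j, approximable (F j)) -> approximable (\sum_(j <- l) c j *: F j).
Proof.
move=> aF; elim: l => [|j l IH]; first by rewrite big_nil; exact: approximable0.
by rewrite big_cons; exact: approximable_lin.
Qed.

Lemma approximable_lim (f : V) :
  (forall eps : R, 0 < eps ->
     exists2 g, approximable g & rnorm (f - g) < eps) ->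
  approximable f.
Proof.
move=> af eps eps0; have e2 : 0 < eps / 2 by rewrite divr_gt0.
have [g ag fg] := af _ e2; have [l gl] := ag _ e2; exists l.
rewrite -(subrK g f) -addrA (le_lt_trans (rnormD _ _))//.
by rewrite (splitr eps) ltrD.
Qed.

Lemma approximable_dense (S : set V) : dense (linear_span S) ->
  (forall v, S v -> approximable v) -> forall f, approximable f.
Proof.
move=> dS aS f; apply: approximable_lim => eps eps0.
have [g [N [c [v [Sv ->]]]] fg] := dense_approx _ dS f _ eps0.
exists (\sum_(i < N) c i *: v i) => //.
by apply: approximable_sum => i; exact/aS.
Qed.

End Approximable.

Section OrthonormalApproximation.
Context {E : hilbertType R k} {I : eqType} (u : I -> E).
Hypothesis u_on : forall i j, inner E (u i) (u j) = (i == j)%:R.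

(** The indices of a good approximating combination are appended to [r]; the projection onto the
    enlarged family is at least as good as that combination. *)
Lemma onproj_approx (r : seq I) (f : E) : uniq r -> approximable u f ->
  forall eps : R, 0 < eps ->
  exists t, uniq (r ++ t) /\ rnorm (f - onproj u (r ++ t) f) < eps.
Proof.
move=> ur af eps eps0; have [l fl] := af _ eps0.
pose t := [seq i <- undup (unzip2 l) | i \notin r].
have urt : uniq (r ++ t).
  rewrite cat_uniq ur filter_uniq ?undup_uniq// andbT /=.
  by apply/hasPn => i; rewrite mem_filter => /andP[].
exists t; split => //; apply: le_lt_trans fl.
(* Repeated indices are merged: the coefficient at [i] is the sum over all pairs of [l] with index
   [i], which is 0 when [i] does not occur in [l]. *)
have -> : \sum_(p <- l) p.1 *: u p.2 =
    \sum_(i <- r ++ t) (\sum_(p <- l | p.2 == i) p.1) *: u i.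
  under [RHS]eq_bigr do rewrite scaler_suml.
  rewrite [RHS](exchange_big_dep xpredT)//= big_seq [RHS]big_seq.
  apply: eq_bigr => p pl.
  have prt : p.2 \in r ++ t.
    rewrite mem_cat mem_filter mem_undup (map_f snd pl) andbT.
    exact: orbN.
  rewrite big_mkcond (bigD1_seq p.2)//= eqxx big1 ?addr0// => i /negbTE.
  by rewrite eq_sym => ->.
exact: onproj_best.
Qed.

End OrthonormalApproximation.

Section TensorBasis.
Context {H : hilbertType R k} (e : nat -> H) (He : orthonormal_basis e).
Context {s : nat} (Hs : tensor_power H s).

Lemma tensor_basis_on (n n' : {ffun 'I_s -> nat}) :
  inner Hs (tensor_basis e Hs n) (tensor_basis e Hs n') = (n == n')%:R.
Proof.
rewrite tensor_inner; case: eqP => [<-|nn'].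
  by rewrite big1// => i _; rewrite He.1 eqxx.
have [i ni] : exists i, n i != n' i.
  apply/existsP; apply: contra_notT nn'; rewrite negb_exists => /forallP h.
  by apply/ffunP => i; apply/eqP; move: (h i); rewrite negbK.
by rewrite (bigD1 i)//= He.1 (negbTE ni) mul0r.
Qed.

Local Notation upd u i x := (@dfwith _ (fun=> H : Type) u i x).

Lemma tensor_upd0 u i : tensor Hs (upd u i 0) = 0.
Proof.
have := tensor_multilinear Hs u i 1 0 0.
by rewrite !scale1r addr0 => /eqP; rewrite -subr_eq subrr => /eqP <-.
Qed.

Lemma tensor_updB u i x y :
  tensor Hs (upd u i x) - tensor Hs (upd u i y) = tensor Hs (upd u i (x - y)).
Proof.
by rewrite (addrC x) -[in RHS]scaleN1r tensor_multilinear scaleN1r addrC.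
Qed.

Lemma rnorm_tensor u : rnorm (tensor Hs u) = \prod_(i < s) rnorm (u i).
Proof.
apply/eqP; rewrite -(@eqrXn2 _ 2)// ?rnorm_ge0//; last first.
  by apply: prodr_ge0 => i _; exact: rnorm_ge0.
rewrite -prodrXl; apply/eqP/(scalar_of_realI (k := k)).
rewrite rnorm_sqr tensor_inner.
rewrite (big_morph scalar_of_real scalar_of_realM scalar_of_real1).
by apply: eq_bigr => i _; rewrite rnorm_sqr.
Qed.

Lemma updE (u : 'I_s -> H) (i : 'I_s) x j :
  (upd u i x : 'I_s -> H) j = if i == j then x else u j.
Proof. by case: eqVneq => [<-|ij]; rewrite ?dfwithin ?dfwithout. Qed.

Lemma approximable_basis (f : H) : approximable e f.
Proof.
apply: (approximable_dense _ _ He.2) => _ [n _ <-].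
exact: approximable_member.
Qed.

Lemma approximable_tensor (u : 'I_s -> H) :
  approximable (tensor_basis e Hs) (tensor Hs u).
Proof.
(* The factors are expanded in the basis e one coordinate at a time: only the
   first t factors of v are arbitrary. *)
suff h t v : (forall i : 'I_s, (t <= i)%N -> exists n, v i = e n) ->
    approximable (tensor_basis e Hs) (tensor Hs v).
  by apply: (h s) => i; rewrite leqNgt ltn_ord.
elim: t v => [|t IH] v hv.
  have [n hn] := choice (fun i => hv i isT).
  suff -> : v = (fun i => e ([ffun i => n i] i)) by exact: approximable_member.
  by apply/funext => i; rewrite ffunE.
have [st|ts] := leqP s t.
  by apply: IH => i ti; have := leq_trans st ti; rewrite leqNgt ltn_ord.
pose i0 := Ordinal ts.
apply: approximable_lim => eps eps0.
(* Replacing the factor at [i0] by [y] changes the tensor by [P] times the distance of [v i0] from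
   [y]. Since [P] may vanish, the tolerance is divided by [P + 1]. *)
pose P := \prod_(i < s | i != i0) rnorm (v i).
have P0 : 0 <= P by apply: prodr_ge0 => i _; exact: rnorm_ge0.
have P1 : 0 < P + 1 by rewrite ltr_wpDl.
have [|l hl] := approximable_basis (v i0) (eps / (P + 1)).
  by rewrite divr_gt0.
set y := \sum_(p <- l) _ in hl.
exists (tensor Hs (upd v i0 y)).
  rewrite /y; elim: {hl y} l => [|p l IHl].
    by rewrite big_nil tensor_upd0; exact: approximable0.
  rewrite big_cons tensor_multilinear; apply: approximable_lin => //.
  apply: IH => i ti; rewrite updE; case: eqVneq => [_|i0i]; first by exists p.2.
  by apply: hv; rewrite ltn_neqAle ti andbT.
have -> : tensor Hs v = tensor Hs (upd v i0 (v i0)).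
  by congr tensor; apply/funext => i; rewrite updE; case: eqP => // <-.
rewrite tensor_updB rnorm_tensor (bigD1 i0)//= updE eqxx.
rewrite (eq_bigr (fun i => rnorm (v i))); last first.
  by move=> i; rewrite updE eq_sym => /negbTE ->.
rewrite -/P (@le_lt_trans _ _ (rnorm (v i0 - y) * (P + 1)))//.
  by rewrite ler_wpM2l ?rnorm_ge0// lerDl.
by rewrite -ltr_pdivlMr.
Qed.

Lemma approximable_tensor_basis (f : Hs) : approximable (tensor_basis e Hs) f.
Proof.
apply: (approximable_dense _ _ (@tensor_total _ _ _ _ Hs)) => _ [u _ <-].
exact: approximable_tensor.
Qed.

End TensorBasis.
End Approximation.

(** * Unordered sums compared with sums over finite lists *)

Section EsumSeq.
Context {R : realType} {I : choiceType}.
Local Open Scope ereal_scope.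

Lemma sum_seq_le_esum (r : seq I) (F : I -> R) : uniq r ->
  (forall i, 0 <= F i)%R ->
  (\sum_(i <- r) F i)%:E <= \esum_(i in [set: I]) (F i)%:E.
Proof.
move=> ur F0; rewrite -sumEFin fsbig_seq//.
by apply: ereal_sup_ubound; exists [set` r].
Qed.

Lemma esum_eq_sum_seq (r : seq I) (F : I -> R) : uniq r ->
  (forall i, 0 <= F i)%R -> (forall i, i \notin r -> F i = 0%R) ->
  \esum_(i in [set: I]) (F i)%:E = (\sum_(i <- r) F i)%:E.
Proof.
move=> ur F0 Fr; rewrite -sumEFin fsbig_seq// -esum_fset//; last first.
  by move=> i _; rewrite lee_fin.
rewrite [RHS]esum_mkcond; apply: eq_esum => i _.
by rewrite mem_setE; case: ifPn => // /Fr ->.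
Qed.

End EsumSeq.

(** * Upper and lower bounds for the minimal error *)

Section ErrorBounds.
Context {R : realType} {k : scalar_kind} {H : hilbertType R k}.
Context {e : nat -> H} (He : orthonormal_basis e).
Context {omega : R} (Homega : 0 < omega < 1) {m : nat -> nat} {a b : nat -> R}.
Hypothesis Ha_pos : forall j, 0 < a j.
Context {s : nat} {Hs : tensor_power H s}.
Local Notation K := (scalar_field R k).
Local Notation w := (weight omega m a b).
Local Notation u := (tensor_basis e Hs).
Local Notation wnorm := (weighted_norm e omega m a b (Hs := Hs)).
Local Notation wspace := (weighted_space e omega m a b (Hs := Hs)).
Local Notation term f n := (w n * rabs (inner Hs f (u n)) ^+ 2).

Let u_on := tensor_basis_on e He Hs.


Lemma weight_ge1 (n : {ffun 'I_s -> nat}) : 1 <= w n.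
Proof.
have /andP[w0 w1] := Homega.
rewrite /weight -[leLHS](powRr0 omega) ger_powR ?w0 ?(ltW w1)//.
by rewrite oppr_le0 sumr_ge0// => j _; rewrite mulr_ge0 ?powR_ge0 ?ltW.
Qed.

Lemma weighted_term_ge0 f n : 0 <= term f n.
Proof. by rewrite mulr_ge0 ?sqr_ge0// powR_ge0. Qed.

Lemma weighted_norm_le1 f : (wnorm f <= 1)%E <->
  (\esum_(n in [set: {ffun 'I_s -> nat}]) (term f n)%:E <= 1)%E.
Proof.
rewrite /weighted_norm poweR12_sqrt; last first.
  by apply: esum_ge0 => n _; rewrite lee_fin weighted_term_ge0.
have : (0 <= \esum_(n in [set: {ffun 'I_s -> nat}]) (term f n)%:E)%E.
  by apply: esum_ge0 => n _; rewrite lee_fin weighted_term_ge0.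
case: (esum _ _) => [r| |]//= r0; rewrite !lee_fin.
rewrite lee_fin in r0.
by rewrite -[X in Num.sqrt r <= X]sqrtr1 ler_psqrt ?nnegrE.
Qed.

(** All weights are at least 1, so a single coefficient is dominated by the weighted norm. This
    makes the coefficient functionals of the projection algorithm continuous on the weighted
    space. *)
Lemma rabs_inner_le_weighted_norm f n :
  ((rabs (inner Hs f (u n)))%:E <= wnorm f)%E.
Proof.
have h : ((rabs (inner Hs f (u n)) ^+ 2)%:E <=
    \esum_(n in [set: {ffun 'I_s -> nat}]) (term f n)%:E)%E.
  apply: le_trans (sum_seq_le_esum [:: n] _ _ (weighted_term_ge0 f)) => //.
  by rewrite big_seq1 lee_fin ler_peMl ?sqr_ge0// weight_ge1.
rewrite /weighted_norm poweR12_sqrt; last first.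
  by apply: esum_ge0 => n' _; rewrite lee_fin weighted_term_ge0.
case: (esum _ _) h => [r| |] /=; [|by rewrite !leey|by rewrite leeNy_eq].
rewrite !lee_fin => h.
by rewrite -[leLHS]ger0_norm ?rabs_ge0// -sqrtr_sqr ler_wsqrtr.
Qed.

Lemma weighted_esum_support f (r : seq {ffun 'I_s -> nat}) : uniq r ->
  (forall n, n \notin r -> inner Hs f (u n) = 0) ->
  (\esum_(n in [set: {ffun 'I_s -> nat}]) (term f n)%:E =
   (\sum_(n <- r) term f n)%:E)%E.
Proof.
move=> ur fr; apply: esum_eq_sum_seq => // n; first exact: weighted_term_ge0.
by move=> /fr ->; rewrite rabs0 expr0n mulr0.
Qed.

(** Functionals are assumed linear on the weighted space only, so finite combinations must be known
    to lie there before a functional is expanded over them. *)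
Lemma weighted_space_comb {J : Type} (l : seq J) (c : J -> K)
  (t : J -> {ffun 'I_s -> nat}) : wspace (\sum_(j <- l) c j *: u (t j)).
Proof.
rewrite /weighted_space /= /weighted_norm.
rewrite (weighted_esum_support _ (undup (map t l))) ?undup_uniq ?ltry//.
move=> n; rewrite mem_undup => nl; rewrite inner_suml.
elim: l nl => [|j l IH]; first by rewrite big_nil.
rewrite inE negb_or => /andP[nj nl]; rewrite big_cons IH// innerZl u_on.
by rewrite eq_sym (negbTE nj) mulr0 addr0.
Qed.

Lemma functional_comb (L : Hs -> K) {J : Type} (l : seq J) (c : J -> K)
  (t : J -> {ffun 'I_s -> nat}) :
  continuous_functional e omega m a b (Hs := Hs) L ->
  L (\sum_(j <- l) c j *: u (t j)) = \sum_(j <- l) c j * L (u (t j)).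
Proof.
move=> [Llin _].
have w0 : wspace 0.
  by have := weighted_space_comb [::] c t; rewrite big_nil.
elim: l => [|j l IH].
  rewrite !big_nil; have := Llin 1 0 0 w0 w0.
  by rewrite scale1r addr0 mul1r => /eqP; rewrite -subr_eq subrr => /eqP <-.
rewrite !big_cons Llin ?IH//; last exact: weighted_space_comb.
have := weighted_space_comb [:: j] (fun=> 1) t.
by rewrite big_seq1 scale1r.
Qed.

Lemma minimal_error_ge (r : seq {ffun 'I_s -> nat}) (n : nat) (c : R) :
  uniq r -> (n < size r)%N -> 0 < c ->
  (forall i, i \in r -> w i * c ^+ 2 <= 1) ->
  (c%:E <= minimal_error e omega m a b Hs n)%E.
Proof.
move=> ur nr c0 hr; apply: le_ereal_inf_tmp => _ [A [L [g [Lc ->]]] <-].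
pose t (j : 'I_(size r)) := tnth (in_tuple r) j.
have t_on i j : inner Hs (u (t i)) (u (t j)) = (i == j)%:R.
  by rewrite u_on inj_eq//; exact/tuple_uniqP.
(* The rank of [M] is at most [n < size r], so its left kernel contains a nonzero row [v]: the
   coefficients of a vector on which all [L i] vanish. *)
pose M : 'M[K]_(size r, n) := \matrix_(j, i) L i (u (t j)).
have /rowV0Pn[v vM v0] : kermx M != 0.
  rewrite -mxrank_eq0 mxrank_ker -lt0n subn_gt0.
  exact: leq_ltn_trans (rank_leq_col M) nr.
pose S := \sum_j rabs (v 0 j) ^+ 2.
have S0 : 0 < S.
  rewrite lt_def sumr_ge0 ?andbT; last by move=> j _; exact: sqr_ge0.
  apply: contraNneq v0 => /eqP; rewrite psumr_eq0; last first.
    by move=> *; exact: sqr_ge0.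
  move=> /allP h; apply/eqP/rowP => j; rewrite mxE.
  have := h j (mem_index_enum _); rewrite implyTb sqrf_eq0.
  by rewrite rabs_eq0 => /eqP.
(* This scaling gives [f] the norm [c]. As the algorithm maps [f] to 0, the error at [f] is then
   exactly [c]. *)
pose q := c / Num.sqrt S.
have q0 : 0 <= q by rewrite divr_ge0 ?sqrtr_ge0// ltW.
have qS : q ^+ 2 * S = c ^+ 2.
  by rewrite expr_div_n sqr_sqrtr ?ltW// divfK// gt_eqF.
pose f := \sum_j (scalar_of_real q * v 0 j) *: u (t j).
have fj j : inner Hs f (u (t j)) = scalar_of_real q * v 0 j.
  rewrite (inner_oncomb (fun j => u (t j)))// ?mem_index_enum//.
  exact: index_enum_uniq.
have f1 : (wnorm f <= 1)%E.
  apply/weighted_norm_le1; rewrite (weighted_esum_support _ r)//; last first.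
    move=> i ir; rewrite inner_suml big1// => j _; rewrite innerZl u_on.
    case: eqP => [ij|]; last by rewrite mulr0.
    by rewrite -ij mem_tnth in ir.
  (* Both sides are multiplied by [c ^+ 2], written as [q ^+ 2 * S] on the right; the claim then
     holds term by term by [hr]. *)
  rewrite lee_fin big_tnth -(@ler_pM2r _ (c ^+ 2)) ?exprn_gt0// mul1r.
  rewrite -[leRHS]qS !big_distrl big_distrr/=; apply: ler_sum => j _.
  rewrite -/(t j) fj rabsM rabs_of_real// exprMn mulrAC -[leRHS]mul1r.
apply: ler_wpM2r; first by rewrite mulr_ge0 ?sqr_ge0.
  by rewrite hr// mem_tnth.
apply: ereal_sup_ubound; exists f => //; congr EFin.
rewrite big1 ?subr0; last first.
  move=> i _; rewrite (functional_comb _ _ _ _ (Lc i)).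
  under eq_bigr do rewrite -mulrA.
  rewrite -mulr_sumr.
  have /rowP/(_ i) : v *m M = 0 by exact/sub_kermxP.
  rewrite !mxE; under eq_bigr do rewrite mxE.
  by move=> ->; rewrite mulr0 scale0r.
apply/eqP; rewrite -(@eqrXn2 _ 2)// ?rnorm_ge0 ?ltW//.
rewrite (rnorm_oncomb (fun j => u (t j)))// ?index_enum_uniq// -qS mulr_sumr.
by apply/eqP/eq_bigr => j _; rewrite rabsM rabs_of_real// exprMn.
Qed.

(** Outside [r], each squared coefficient is at most [c ^+ 2] times its weighted version, and the
    weighted versions sum to at most 1. *)
Lemma rnorm_sub_onproj_le (r : seq {ffun 'I_s -> nat}) (c : R) f : uniq r ->
  0 <= c -> (forall i, i \notin r -> 1 <= w i * c ^+ 2) ->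
  (wnorm f <= 1)%E -> rnorm (f - onproj u r f) <= c.
Proof.
move=> ur c0 hr /weighted_norm_le1 f1.
rewrite -(@ler_pXn2r _ 2)// ?nnegrE ?rnorm_ge0//.
(* Only finite sums are used: extending [r] by a suitable finite [t] leaves a squared residual of at
   most [eps], and the coefficients on [t] contribute at most [c ^+ 2]. *)
apply/ler_addgt0Pr => eps eps0.
have d0 : 0 < Num.sqrt eps by rewrite sqrtr_gt0.
have fu := approximable_tensor_basis e He Hs f.
have [t [urt ht]] := onproj_approx u u_on r f ur fu _ d0.
rewrite (rnorm_sub_onproj_cat u u_on r t f urt) addrC lerD//; last first.
  rewrite -(sqr_sqrtr (ltW eps0)) ler_pXn2r ?nnegrE ?rnorm_ge0 ?sqrtr_ge0//.
  exact: ltW.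
have /and3P[_ /hasPn rt ut] : [&& uniq r, ~~ has (mem r) t & uniq t].
  by rewrite -cat_uniq.
have ft : \sum_(n <- t) term f n <= 1.
  rewrite -lee_fin; apply: le_trans f1.
  by apply: sum_seq_le_esum => // n; exact: weighted_term_ge0.
rewrite -[leRHS]mul1r (le_trans _ (ler_wpM2r (sqr_ge0 c) ft))//.
rewrite mulr_suml big_seq [leRHS]big_seq; apply: ler_sum => i it.
rewrite mulrAC -[leLHS]mul1r ler_wpM2r ?sqr_ge0// hr//.
exact: rt.
Qed.

Lemma minimal_error_le (r : seq {ffun 'I_s -> nat}) (n : nat) (c : R) :
  uniq r -> (size r <= n)%N -> 0 <= c ->
  (forall i, i \notin r -> 1 <= w i * c ^+ 2) ->
  (minimal_error e omega m a b Hs n <= c%:E)%E.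
Proof.
move=> ur rn c0 hr.
pose d : {ffun 'I_s -> nat} := [ffun=> 0%N].
pose L (i : 'I_n) (f : Hs) : K := inner Hs f (u (nth d r i)).
(* When [r] has fewer than [n] elements, the surplus functionals use the default index [d]; the zero
   vectors here cancel them. *)
pose g (i : 'I_n) : Hs := if (i < size r)%N then u (nth d r i) else 0.
have LgE f : \sum_(i < n) L i f *: g i = onproj u r f.
  pose F i := inner Hs f (u (nth d r i)) *: u (nth d r i).
  rewrite /onproj (big_nth d) big_mkord (big_ord_widen _ F rn).
  rewrite [RHS]big_mkcond; apply: eq_bigr => i _; rewrite /L /g /F.
  by case: ifP => //; rewrite scaler0.
apply: (@le_trans _ _ (worst_case_error e omega m a b (onproj u r))).
  apply: ereal_inf_lbound; exists (onproj u r) => //; exists L, g; split.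
    move=> i; split=> [q f f' _ _|f _ eps eps0].
      by rewrite /L innerDl innerZl.
    exists eps => // f' _.
    move/(le_lt_trans (rabs_inner_le_weighted_norm _ (nth d r i))).
    by rewrite lte_fin innerBl.
  by apply/funext => f; rewrite LgE.
apply: ge_ereal_sup => _ [f /= f1 <-].
by rewrite lee_fin; exact: rnorm_sub_onproj_le.
Qed.

End ErrorBounds.

(** * Block indices *)

Section Blocks.
Variable m : nat -> nat.
Hypothesis m_pos : forall i, (0 < m i)%N.

Lemma leq_block_start k : (k <= block_start m k)%N.
Proof.
rewrite /block_start; elim: k => // k IH; rewrite big_ord_recr/= -addn1.
exact: leq_add.
Qed.

Lemma block_start_leq M k : (forall i, (m i <= M)%N) ->
  (block_start m k <= M * k)%N.
Proof.
move=> mM; rewrite /block_start; elim: k => [|k IH]; first by rewrite big_ord0.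
by rewrite big_ord_recr/= mulnS addnC leq_add.
Qed.

(** [block_index] is defined by choice, so a witness is needed: the least [k] whose block ends
    beyond [n]. By minimality its block starts at or before [n]. *)
Lemma block_indexP n :
  (block_start m (block_index m n) <= n < block_start m (block_index m n).+1)%N.
Proof.
apply: (@getPex _ [set k | (block_start m k <= n < block_start m k.+1)%N]).
have ex : exists k, (n < block_start m k.+1)%N.
  by exists n; exact: leq_block_start.
case: (ex_minnP ex) => k nk mink; exists k => /=; rewrite nk andbT.
case: k nk mink => [|k] _ mink; first by rewrite /block_start big_ord0.
by rewrite leqNgt; apply/negP => /mink; rewrite ltnn.
Qed.

Lemma block_index_leq n : (block_index m n <= n)%N.
Proof.
have /andP[h _] := block_indexP n.
exact: leq_trans (leq_block_start _) h.
Qed.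

Lemma leq_block_index M K n : (forall i, (m i <= M)%N) ->
  (M * K <= n)%N -> (K <= block_index m n)%N.
Proof.
move=> mM; apply: contraTT; rewrite -!ltnNge => nK.
have /andP[_ h] := block_indexP n.
apply: leq_trans h _; apply: leq_trans (block_start_leq _ _ mM) _.
by rewrite leq_mul2l nK orbT.
Qed.

End Blocks.

(** * Boxes of multi-indices *)

Section Box.
Context {s : nat} (N : 'I_s -> nat).

(** Enumerating dependent finite functions with values in ['I_(N j)] gives a duplicate-free list
    whose length is the product of the sides. *)
Definition box : seq {ffun 'I_s -> nat} :=
  [seq [ffun j => nat_of_ord (g j)] | g : {dffun forall j, 'I_(N j)}].

Lemma box_uniq : uniq box.
Proof.
apply/injectiveP => g g' /ffunP gg'; apply/ffunP => j; apply: val_inj.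
by have := gg' j; rewrite !ffunE.
Qed.

Lemma mem_box (n : {ffun 'I_s -> nat}) :
  reflect (forall j, (n j < N j)%N) (n \in box).
Proof.
apply: (iffP fintype.imageP) => [[g _ ->] j|h]; first by rewrite ffunE.
exists [ffun j => Ordinal (h j)] => //; apply/ffunP => j.
by rewrite !ffunE.
Qed.

Lemma size_box : size box = (\prod_(j < s) N j)%N.
Proof.
rewrite size_image card_dep_ffun foldrE big_map big_enum/=.
by apply: eq_bigr => j _; rewrite card_ord.
Qed.

End Box.

(** * Counting the multi-indices of bounded cost *)

Section Counting.
Context {R : realType} (m : nat -> nat) (a b : nat -> R).
Hypothesis m_pos : forall i, (0 < m i)%N.
Hypothesis a_pos : forall j, 0 < a j.
Hypothesis b_pos : forall j, 0 < b j.

Definition cost {s : nat} (n : {ffun 'I_s -> nat}) : R :=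
  \sum_(j < s) a j * (block_index m (n j))%:R `^ b j.

Local Notation B s := (\sum_(j < s) (b j)^-1).

Lemma cost_ge0 s (n : {ffun 'I_s -> nat}) : 0 <= cost n.
Proof. by apply: sumr_ge0 => j _; rewrite mulr_ge0 ?powR_ge0 ?ltW. Qed.

Lemma powR_sum (I : Type) (r : seq I) (x : R) (F : I -> R) : 0 < x ->
  x `^ (\sum_(i <- r) F i) = \prod_(i <- r) x `^ F i.
Proof.
move=> x0; elim: r => [|i r IH]; first by rewrite !big_nil powRr0.
by rewrite !big_cons powRD ?IH// (gt_eqF x0) implybT.
Qed.

Lemma mul_powR_le (x y T c : R) : 0 < c -> 0 < y -> 0 <= x ->
  (x <= (T / c) `^ y^-1) -> 0 <= T -> c * x `^ y <= T.
Proof.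
move=> c0 y0 x0 xT T0; rewrite mulrC -ler_pdivlMr//.
have Tc : 0 <= T / c by rewrite mulr_ge0 ?invr_ge0 ?(ltW c0).
rewrite -[leRHS](powRr1 Tc) -(mulVf (lt0r_neq0 y0)) powRrM.
by rewrite ge0_ler_powR ?nnegrE ?powR_ge0 ?(ltW y0).
Qed.

Lemma mul_powR_ge (x y T c : R) : 0 < c -> 0 < y ->
  ((T / c) `^ y^-1 <= x) -> 0 <= T -> T <= c * x `^ y.
Proof.
move=> c0 y0 xT T0; rewrite mulrC -ler_pdivrMr//.
have Tc : 0 <= T / c by rewrite mulr_ge0 ?invr_ge0 ?(ltW c0).
rewrite -[leLHS](powRr1 Tc) -(mulVf (lt0r_neq0 y0)) powRrM.
rewrite ge0_ler_powR ?nnegrE ?powR_ge0 ?(ltW y0)//.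
by rewrite (le_trans _ xT) ?powR_ge0.
Qed.

(** A multi-index outside a suitable box has one coordinate that alone costs at least [T]. *)
Lemma count_cost_le s : (exists M, forall i, (m i <= M)%N) ->
  exists2 C : R, 0 < C & forall T : R, exists r : seq {ffun 'I_s -> nat},
    [/\ uniq r, (size r)%:R <= C * (1 + T) `^ B s &
        forall n, n \notin r -> T <= cost n].
Proof.
move=> [M mM]; have M0 : (0 < M)%N := leq_trans (m_pos 0) (mM 0).
exists (\prod_(j < s) (M%:R * ((a j)^-1 `^ (b j)^-1 + 1))).
  by apply: prodr_gt0 => j _; rewrite mulr_gt0 ?ltr0n// ltr_wpDl ?powR_ge0.
(* For negative [T] the empty list suffices, since costs are nonnegative. *)
move=> T; have [T0|T0] := ltP T 0.
  exists [::]; split => // [|n _]; last first.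
    by rewrite (le_trans (ltW T0))// cost_ge0.
  rewrite mulr_ge0 ?powR_ge0// prodr_ge0// => j _.
  by rewrite mulr_ge0 ?addr_ge0 ?powR_ge0.
(* As blocks have length at most [M], a coordinate beyond this side has a block index above
   (T/a_j)^(1/b_j), hence costs at least [T]. *)
pose N (j : 'I_s) := (M * (Num.trunc ((T / a j) `^ (b j)^-1)).+1)%N.
exists (box N); split; first exact: box_uniq.
  (* Factor by factor, this is (T/a_j)^(1/b_j) + 1 <= (a_j^(-1/b_j) + 1) (1+T)^(1/b_j). *)
  rewrite size_box natr_prod powR_sum ?ltr_pwDl// -big_split/=.
  apply: ler_prod => j _; rewrite ler0n/= natrM -mulrA ler_wpM2l//.
  rewrite mulrDl mul1r -powRM ?invr_ge0 ?addr_ge0 ?(ltW (a_pos j))//.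
  rewrite -natr1 lerD//.
    rewrite (le_trans (y := (T / a j) `^ (b j)^-1)) ?truncn_le ?powR_ge0//.
    rewrite ge0_ler_powR ?nnegrE ?mulr_ge0 ?invr_ge0 ?addr_ge0//;
      rewrite ?(ltW (a_pos j)) ?(ltW (b_pos j))//.
    by rewrite mulrC ler_wpM2l ?invr_ge0 ?(ltW (a_pos j))// lerDr.
  (* The constant 1 is read as a power of 1, so that monotonicity in the base applies. *)
  rewrite -[leLHS]/((fun=> 1) ((b j)^-1)) -(powR1 R).
  rewrite ge0_ler_powR ?nnegrE ?invr_ge0 ?addr_ge0 ?(ltW (b_pos j))//.
  by rewrite lerDl.
move=> n /mem_box nbox.
have [j] : exists j, (N j <= n j)%N.
  apply: contra_notP nbox => h j; rewrite ltnNge; apply/negP => Nj.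
  by apply: h; exists j.
move/(leq_block_index _ m_pos _ _ _ mM) => hj.
rewrite /cost (bigD1 j)//=.
rewrite (le_trans (y := a j * (block_index m (n j))%:R `^ b j))//.
  apply: mul_powR_ge => //; apply: le_trans (ltW (truncnS_gt _)) _.
  by rewrite ler_nat.
by rewrite lerDl sumr_ge0// => i _; rewrite mulr_ge0 ?powR_ge0 ?ltW.
Qed.

(** The budget [T] is split evenly: in the chosen box each coordinate costs at most T/s, because the
    block index never exceeds the index itself. *)
Lemma count_cost_ge s : (0 < s)%N ->
  exists2 C : R, 0 < C & forall T : R, 0 < T ->
    exists r : seq {ffun 'I_s -> nat},
    [/\ uniq r, C * T `^ B s <= (size r)%:R & forall n, n \in r -> cost n <= T].
Proof.
move=> s0; have c0 j : 0 < a j * s%:R by rewrite mulr_gt0 ?ltr0n.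
exists (\prod_(j < s) (a j * s%:R)^-1 `^ (b j)^-1).
  by apply: prodr_gt0 => j _; rewrite powR_gt0 ?invr_gt0.
move=> T T0.
pose N (j : 'I_s) := (Num.trunc ((T / (a j * s%:R)) `^ (b j)^-1)).+1.
exists (box N); split; first exact: box_uniq.
  rewrite size_box natr_prod powR_sum// -big_split/=.
  apply: ler_prod => j _; rewrite mulr_ge0 ?powR_ge0//=.
  rewrite -powRM ?invr_ge0 ?(ltW (c0 j)) ?(ltW T0)// mulrC.
  by rewrite ltW// truncnS_gt.
move=> n /mem_box nbox.
have -> : T = \sum_(j < s) T / s%:R.
  by rewrite sumr_const card_ord -[RHS]mulr_natr divfK// pnatr_eq0 -lt0n.
apply: ler_sum => j _; apply: mul_powR_le => //; last first.
  by rewrite mulr_ge0 ?invr_ge0 ?(ltW T0).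
rewrite (le_trans (y := (n j)%:R))// ?ler_nat ?block_index_leq//.
rewrite -truncn_ge_nat ?powR_ge0// -mulrA -invfM (mulrC s%:R).
by have := nbox j.
Qed.

End Counting.

(** * Comparison of exponents in exponential bounds *)

Section ExpBound.
Context {R : realType}.

Lemma ereal_sup_max (A : set R) (x : R) : A x -> (forall y, A y -> y <= x) ->
  ereal_sup [set y%:E | y in A] = x%:E.
Proof.
move=> Ax xA; apply/eqP; rewrite eq_le; apply/andP; split.
  by apply: ge_ereal_sup => _ [y Ay <-]; rewrite lee_fin xA.
by apply: ereal_sup_ubound; exists x.
Qed.

(** With x = n/M, x^p' <= x^p + 1: for x >= 1 by monotonicity in the exponent, otherwise because
    x^p' <= 1. The extra 1 is absorbed by the constant C/q. *)
Lemma exp_bound_antitone (err : nat -> \bar R) (q p p' : R) :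
  0 < q < 1 -> 0 < p' <= p -> exp_bound err q p -> exp_bound err q p'.
Proof.
move=> /andP[q0 q1] /andP[p'0 p'p] [C [M [C0 M0 h]]].
exists (C / q), M; split; rewrite ?divr_gt0// => n n0.
apply: le_trans (h n n0) _; rewrite lee_fin -mulrA ler_wpM2l ?(ltW C0)//.
have nM : 0 <= n%:R / M by rewrite mulr_ge0 ?invr_ge0 ?(ltW M0).
rewrite [leRHS]mulrC ler_pdivlMr// -[X in _ * X <= _](powRr1 (ltW q0)).
rewrite -powRD ?(gt_eqF q0) ?implybT//.
rewrite ger_powR ?q0 ?(ltW q1)//.
have [Mn|nM1] := leP 1 (n%:R / M).
  rewrite (le_trans (y := (n%:R / M) `^ p)) ?lerDl// .
  by rewrite ler_powR.
rewrite (le_trans (y := 1)) ?lerDr ?powR_ge0//.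
rewrite -[leRHS]/((fun=> 1) p') -(powR1 R) ge0_ler_powR ?nnegrE ?(ltW p'0)//.
exact: ltW.
Qed.

(** Taking logarithms of both bounds gives n^p <= F n^beta for all n >= 1, which fails for large n
    if p > beta. *)
Lemma exp_bound_exponent_le (err : nat -> \bar R) (q p v D beta : R) :
  0 < q < 1 -> 0 < v < 1 -> 0 < beta ->
  (forall n, (0 < n)%N -> ((v `^ (D * n%:R `^ beta))%:E <= err n)%E) ->
  exp_bound err q p -> p <= beta.
Proof.
move=> /andP[q0 q1] /andP[v0 v1] beta0 hv [C [M [C0 M0 h]]].
rewrite leNgt; apply/negP => bp.
have lnq : 0 < - ln q by rewrite oppr_gt0 ln_lt0// q0.
have lnv : 0 < - ln v by rewrite oppr_gt0 ln_lt0// v0.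
(* Since n^beta >= 1, the constant ln C is absorbed as |ln C| n^beta. The [n] below is chosen so
   that n^(p-beta) exceeds |F|. *)
pose F := (`|ln C| + D * - ln v) / (- ln q) * M `^ p.
pose n := (Num.trunc (`|F| `^ (p - beta)^-1)).+1.
have n0 : 0 < n%:R :> R by rewrite ltr0n.
have n1 : 1 <= n%:R :> R by rewrite ler1n.
have : F < n%:R `^ (p - beta).
  rewrite (le_lt_trans (ler_norm F))//.
  have pb : 0 < p - beta by rewrite subr_gt0.
  rewrite -[ltLHS](powRr1 (normr_ge0 F)).
  rewrite -[X in _ `^ X < _](mulVf (lt0r_neq0 pb)) powRrM.
  by rewrite gt0_ltr_powR ?nnegrE ?powR_ge0// truncnS_gt.
apply/negP; rewrite -leNgt.
rewrite -(ler_pM2l (powR_gt0 beta n0)) -powRD ?(gt_eqF n0) ?implybT//.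
rewrite addrC subrK /F mulrA -ler_pdivrMr ?powR_gt0//.
rewrite mulrA ler_pdivlMr//.
have := le_trans (hv n isT) (h n isT); rewrite lee_fin.
rewrite -ler_ln ?posrE ?mulr_gt0 ?powR_gt0// lnM ?posrE ?powR_gt0// !ln_powR.
rewrite powRM ?invr_ge0 ?(ltW M0)// -powR_inv1 ?(ltW M0)//.
rewrite powRAC powR_inv1 ?powR_ge0//.
rewrite mulrN => hh.
rewrite (le_trans (y := ln C + D * n%:R `^ beta * - ln v))//.
  move: hh; lra.
rewrite mulrDr lerD//; last by rewrite mulrCA mulrA.
rewrite (le_trans (ler_norm _))// ler_peMl//.
rewrite -[leLHS](powRr0 n%:R) ler_powR// ltW//.
Qed.

End ExpBound.

(** * Decay of the minimal error for fixed dimension *)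

Section MinimalErrorBounds.
Context {R : realType} {k : scalar_kind} {H : hilbertType R k}.
Context {e : nat -> H} (He : orthonormal_basis e).
Context {omega : R} (Homega : 0 < omega < 1).
Context {m : nat -> nat} (Hm_pos : forall i, (0 < m i)%N).
Hypothesis Hm_bdd : exists M, forall i, (m i <= M)%N.
Context {a b : nat -> R}.
Hypothesis Ha_pos : forall j, 0 < a j.
Hypothesis Hb_pos : forall j, 0 < b j.
Context {s : nat} (Hs : tensor_power H s) (s_gt0 : (0 < s)%N).
Local Notation B := (\sum_(j < s) (b j)^-1).
Local Notation err := (minimal_error e omega m a b Hs).

Lemma sum_inv_gt0 : 0 < B.
Proof.
case: s s_gt0 => // s' _; rewrite big_ord_recl ltr_pwDl ?invr_gt0//.
by apply: sumr_ge0 => j _; rewrite invr_ge0 ltW.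
Qed.

(** With [c] equal to omega^(T/2), the hypotheses of the two error bounds become comparisons of
    [cost] with [T]. *)
Lemma weight_mul_sqr (n : {ffun 'I_s -> nat}) (T : R) :
  weight omega m a b n * (omega `^ (T / 2)) ^+ 2 = omega `^ (T - cost m a b n).
Proof.
have /andP[w0 _] := Homega.
rewrite expr2 -!powRD ?(gt_eqF w0) ?implybT//.
by congr (_ `^ _); rewrite /cost; lra.
Qed.

Lemma exp_bound_minimal_error : exp_bound err (omega `^ 2^-1) B^-1.
Proof.
have /andP[w0 w1] := Homega.
have [C C0 hC] := count_cost_le m a b Hm_pos Ha_pos Hb_pos s Hm_bdd.
exists (omega `^ (- 2^-1)), C; split; rewrite ?powR_gt0// => n n0.
have nC : 0 <= n%:R / C by rewrite mulr_ge0 ?invr_ge0 ?(ltW C0).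
(* This T solves C (1+T)^B = n, so [r] has at most [n] elements. Its summand -1 is what the
   prefactor omega^(-1/2) compensates. *)
have [r [ur sr hr]] := hC ((n%:R / C) `^ B^-1 - 1).
rewrite -powRrM -powRD ?(gt_eqF w0) ?implybT//.
have -> : - 2^-1 + 2^-1 * (n%:R / C) `^ B^-1 = ((n%:R / C) `^ B^-1 - 1) / 2.
  by lra.
apply: (minimal_error_le He Homega Ha_pos r) => //; first 1 last.
- by rewrite powR_ge0.
- move=> i /hr hi; rewrite weight_mul_sqr -[leLHS](powRr0 omega).
  by rewrite ger_powR ?w0 ?(ltW w1)// subr_le0.
rewrite -(ler_nat R) (le_trans sr)// addrC subrK -powRrM.
by rewrite mulVf ?(gt_eqF sum_inv_gt0)// powRr1// mulrC divfK// gt_eqF.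
Qed.

Lemma minimal_error_lower_bound : exists2 D : R, 0 < D &
  forall n, (0 < n)%N -> ((omega `^ (D * n%:R `^ B^-1))%:E <= err n)%E.
Proof.
have /andP[w0 w1] := Homega.
have [C C0 hC] := count_cost_ge m a b Hm_pos Ha_pos Hb_pos s s_gt0.
(* With T = (2n/C)^(1/B) the count is at least C T^B = 2n, strictly more than [n]; D n^(1/B) equals
   T/2. *)
exists ((2 / C) `^ B^-1 / 2); first by rewrite divr_gt0 ?powR_gt0 ?divr_gt0.
move=> n n0; have n0' : 0 < n%:R :> R by rewrite ltr0n.
have T0 : 0 < (2 / C * n%:R) `^ B^-1 by rewrite powR_gt0 ?mulr_gt0 ?invr_gt0.
have [r [ur sr hr]] := hC _ T0.
have C2 : 0 <= 2 / C by rewrite mulr_ge0 ?invr_ge0 ?(ltW C0).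
rewrite mulrAC -powRM ?(ltW n0')//.
apply: (minimal_error_ge He r) => //; last 2 first.
- by rewrite powR_gt0.
- move=> i /hr hi; rewrite weight_mul_sqr -[leRHS](powRr0 omega).
  by rewrite ger_powR ?w0 ?(ltW w1)// subr_ge0.
rewrite -(ltr_nat R) (lt_le_trans _ sr)// -powRrM mulVf ?(gt_eqF sum_inv_gt0)//.
rewrite powRr1 ?mulr_ge0 ?invr_ge0 ?(ltW C0) ?(ltW n0')//.
have -> : C * (2 / C * n%:R) = n%:R * 2 by field; rewrite gt_eqF.
by rewrite ltr_pMr// ltr1n.
Qed.

End MinimalErrorBounds.

(** * Passage to all dimensions: partial sums, EXP and UEXP *)

Lemma partial_sum_le_nneseries (R : realType) (u : nat -> R) (s : nat) :
  (forall j, 0 <= u j) ->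
  ((\sum_(j < s) u j)%:E <= \sum_(0 <= j <oo) (u j)%:E)%E.
Proof.
move=> u0; rewrite (nneseries_split 0 s); last by move=> j _; rewrite lee_fin.
rewrite add0n big_mkord sumEFin leeDl// nneseries_ge0// => j _ _.
by rewrite lee_fin.
Qed.

Lemma nneseries_le_bound (R : realType) (u : nat -> R) (c : R) :
  (forall j, 0 <= u j) -> (forall s, (0 < s)%N -> \sum_(j < s) u j <= c) ->
  (\sum_(0 <= j <oo) (u j)%:E <= c%:E)%E.
Proof.
move=> u0 hc; apply: lime_le.
  by apply: is_cvg_nneseries => j _ _; rewrite lee_fin.
near=> s; rewrite big_mkord sumEFin lee_fin; apply: hc.
by near: s; exists 1%N.
Unshelve. all: by end_near. Qed.

Theorem theorem1 (R : realType) (k : scalar_kind) (H : hilbertType R k)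
  (e : nat -> H) (He : orthonormal_basis e)
  (omega : R) (Homega : 0 < omega < 1)
  (m : nat -> nat) (Hm_pos : forall i, (0 < m i)%N)
  (Hm_bdd : exists M, forall i, (m i <= M)%N)
  (a b : nat -> R)
  (Ha_pos : forall j, 0 < a j) (Ha_mono : forall j, a j <= a j.+1)
  (Hb_pos : forall j, 0 < b j) (Hb_inf : 0 < inf (range b))
  (Hs : forall s, tensor_power H s) :
  let err := fun s n => minimal_error e omega m a b (Hs s) n in
  let B := (\sum_(0 <= j <oo) ((b j)^-1)%:E)%E in
  (EXP err /\
   forall s, (0 < s)%N ->
     EXP_exponent err s = ((\sum_(j < s) (b j)^-1)^-1)%:E) /\
  ((UEXP err <-> (B < +oo)%E) /\
   ((B < +oo)%E -> UEXP_exponent err = ((fine B)^-1)%:E)).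
Proof.
move=> err B; have /andP[w0 w1] := Homega.
have q01 : 0 < omega `^ 2^-1 < 1.
  rewrite powR_gt0//= -[ltRHS]/((fun=> 1) (2^-1 : R)) -(powR1 R).
  by rewrite gt0_ltr_powR ?nnegrE ?(ltW w0).
have Bs0 s : (0 < s)%N -> 0 < \sum_(j < s) (b j)^-1 by exact: sum_inv_gt0.
have upper s : (0 < s)%N ->
    exp_bound (err s) (omega `^ 2^-1) (\sum_(j < s) (b j)^-1)^-1.
  exact: exp_bound_minimal_error.
have lower s q p : (0 < s)%N -> 0 < q < 1 -> exp_bound (err s) q p ->
    p <= (\sum_(j < s) (b j)^-1)^-1.
  move=> s0 hq hp; have [D _ hD] :=
    minimal_error_lower_bound He Homega Hm_pos Ha_pos Hb_pos (Hs s) s0.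
  by apply: exp_bound_exponent_le hq Homega _ hD hp; rewrite invr_gt0 Bs0.
have b0 j : 0 <= (b j)^-1 by rewrite invr_ge0 ltW.
(* A uniform exponent [p] satisfies p <= 1/B_s for every s, so 1/p bounds all partial sums and hence
   the series. *)
have UEXP_le p : UEXP_with err p -> (B <= (p^-1)%:E)%E.
  move=> [p0 [q hq hp]]; apply: nneseries_le_bound => // s s0.
  rewrite -[leLHS]invrK lef_pV2 ?posrE ?invr_gt0 ?Bs0//.
  exact: lower s0 hq (hp s s0).
have Bfin : (B < +oo)%E -> B \is a fin_num.
  by rewrite ge0_fin_numE// nneseries_ge0// => j _ _; rewrite lee_fin.
(* The bound with exponent 1/B_s weakens to 1/B <= 1/B_s, and its base is the same for all s. *)
have UEXP_with_inv : (B < +oo)%E -> 0 < fine B /\ UEXP_with err (fine B)^-1.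
  move=> Boo; have BsB s : \sum_(j < s) (b j)^-1 <= fine B.
    by rewrite -lee_fin fineK ?Bfin//; exact: partial_sum_le_nneseries.
  have B0 : 0 < fine B := lt_le_trans (Bs0 1 isT) (BsB 1%N).
  split => //; split; first by rewrite invr_gt0.
  exists (omega `^ 2^-1) => // s s0.
  apply: exp_bound_antitone (upper s s0) => //.
  by rewrite invr_gt0 B0 lef_pV2 ?posrE ?Bs0 ?BsB.
split; split.
- exists (omega `^ 2^-1) => // s s0.
  by exists (\sum_(j < s) (b j)^-1)^-1; [rewrite invr_gt0 Bs0|exact: upper].
(* The supremum is attained: [upper] puts 1/B_s in the set and [lower] bounds every member by it. *)
- move=> s s0; apply: ereal_sup_max => [|p [p0 [q hq hp]]].
    by split; [rewrite invr_gt0 Bs0|exists (omega `^ 2^-1) => //; exact: upper].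
  exact: lower s0 hq hp.
- split=> [[p /UEXP_le h]|/UEXP_with_inv[_ h]].
    exact: le_lt_trans h (ltry _).
  by exists (fine B)^-1.
- move=> Boo; have [B0 h] := UEXP_with_inv Boo.
  apply: ereal_sup_max => // p hp; have [p0 _] := hp.
  rewrite -[leLHS]invrK lef_pV2 ?posrE ?invr_gt0//.
  by rewrite -lee_fin fineK ?UEXP_le// Bfin.
Qed.
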